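(* Consider $M\ge 1$ repetitions of the quantum remote sensing protocol (described in the context) with parameters $\epsilon,\delta,\Delta$ satisfying $0<\epsilon<1/2$, $0<\delta\le 1$, $0\le\Delta<\epsilon/3$, and interaction time $t>0$. Assume that the repetitions are independent of each other and that in every repetition the number of failing registers satisfies $N_{\rm fail}\le 2k\Delta$ with unit probability. Let $\delta\omega_C$ be the client's uncertainty in estimating $\omega$ (defined in the context). Then, in the limit of small $\omega$ (i.e. $\omega\to 0$), $$\delta\omega_C\le\frac{1}{t}\sqrt{\frac{1}{M}+4(\epsilon-\epsilon^2)}$$ with probability at least $(1-\delta)^M$.
   Context: $I$ is the $2\times 2$ identity matrix, $\hat\sigma_x,\hat\sigma_y,\hat\sigma_z$ are the Pauli matrices, $|\pm\rangle=(|0\rangle\pm|1\rangle)/\sqrt2$, $|\Phi^+\rangle=(|00\rangle+|11\rangle)/\sqrt2$. The unknown real parameter $\omega$ enters through the single-qubit Hamiltonian $\hat{\mathcal H}=\frac{\hbar\omega}{2}\hat\sigma_z$. One repetition of the protocol. Let $k=\left\lceil\frac{75}{8(\epsilon-3\Delta)^2}\log\frac{2}{\delta}\right\rceil$ ($\log$ is the natural logarithm). An $8k$-qubit state $\rho_S$ consisting of $4k$ two-qubit registers is shared between client and server, each holding one qubit of every register. Because of noise, $\rho_S$ is an arbitrary $8k$-qubit state (registers may be entangled with each other, no i.i.d. assumption), not depending on $\omega$. The client chooses uniformly at random $k$ of the $4k$ registers (the $X$ set), then $k$ of the remaining $3k$ registers (the $Z$ set), then one of the remaining $2k$ registers (the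 target register); the other $2k-1$ registers are discarded. Each register in the $X$ set (resp. $Z$ set) is measured in the $\hat\sigma_x\otimes\hat\sigma_x$ (resp. $\hat\sigma_z\otimes\hat\sigma_z$) basis and fails if its two single-qubit outcomes differ. $N_{\rm fail}$ is the total number of failing registers in the $X$ and $Z$ sets. Let $\rho_{\rm tgt}$ be the two-qubit state of the target register, given the choice of the $X$ and $Z$ sets and the measurement outcomes on them, and averaged over the uniformly random choice of the target register. The client measures his/her qubit of the target register in the $\hat\sigma_x$ basis with outcome $s\in\{0,1\}$ ($s=0$ for $|+\rangle$, $s=1$ for $|-\rangle$); $p_s$ is the probability of outcome $s$ and $\rho^{(s)}$ the resulting state of the server's qubit. The server's qubit evolves under $\hat{\mathcal H}$ for time $t$ and is measured in the $\hat\sigma_y$ basis with outcome $o\in\{0,1\}$, where $o=1$ corresponds to the projector $\hat{\mathcal P}=(I+\hat\sigma_y)/2$; $o$ is sent to the client, who records $m'=s\oplus o$. Equivalently, $m'=1$ occurs with probability $P'={\rm Tr}[\hat{\mathcal P}e^{-i\hat{\mathcal H}t/\hbar}\rho_0e^{i\hat{\mathcal H}t/\hbar}]$, where $\rho_0=\sum_{s=0,1}p_s\hat\sigma_z^s\rho^{(s)}\hat\sigma_z^s$. Client's uncertainty. From the $M$ independent recorded values $m'_1,\dots,m'_M$ let $S'_M=\frac1M\sum_{j=1}^Mm'_j$. The client, not knowing the actual states, uses the estimator that would be appropriate for the ideal Bell pair (for which the probability of recording $1$ is $\simeq(1+\omega t)/2$), namely ${\omega'}_M^{({\rm est})}=(2S'_M-1)/t$.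 The uncertainty is $\delta\omega_C=\sqrt{\langle({\omega'}_M^{({\rm est})}-\omega)^2\rangle}$, where $\langle\cdot\rangle$ is the statistical average over the recorded values for given target-register states in the $M$ repetitions. The probability in the conclusion is over the random choices and test-measurement outcomes determining the states $\rho_{\rm tgt}$ in the $M$ repetitions. *)

(* Defs.v *)
From mathcomp Require Export all_boot all_order all_algebra.
From mathcomp Require Export all_classical all_reals all_analysis.
From mathcomp Require Export sesquilinear complex.

Export Order.TTheory GRing.Theory Num.Theory numFieldNormedType.Exports.

Set Implicit Arguments.
Unset Strict Implicit.
Unset Printing Implicit Defensive.

Local Open Scope classical_set_scope.
Local Open Scope sesquilinear_scope.
Local Open Scope ring_scope.

(* Operators on the Hilbert space whose computational basis is the finite type
   [T]; rows and columns follow the enumeration of [T]. A qubit has basis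
   [bool] (|0> is [false], |1> is [true]), a two-qubit register has basis
   [bool * bool] (first component: client, second component: server), and a
   family of [n] registers has basis [{ffun 'I_n -> bool * bool}]. *)
Definition op (R : realType) (T : finType) := 'M[R[i]]_#|T|.

Definition mkop (R : realType) (T : finType) (f : T -> T -> R[i]) : op R T :=
  \matrix_(i, j) f (enum_val i) (enum_val j).

Definition entry (R : realType) (T : finType) (A : op R T) (x y : T) : R[i] :=
  A (enum_rank x) (enum_rank y).

Definition density (R : realType) (T : finType) (rho : op R T) : Prop :=
  [/\ rho ^t* = rho,
      forall u : 'cV[R[i]]_#|T|, 0 <= (u ^t* *m rho *m u) 0 0
    & \tr rho = 1].

Definition tens2 (R : realType) (S T : finType) (A : op R S) (B : op R T) :
    op R (S * T)%type :=
  mkop (fun x y => entry A x.1 y.1 * entry B x.2 y.2).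

Definition tens (R : realType) (I T : finType) (A : I -> op R T) :
    op R {ffun I -> T} :=
  mkop (fun x y : {ffun I -> T} => \prod_i entry (A i) (x i) (y i)).

Definition ptrace_fst (R : realType) (S T : finType) (A : op R (S * T)%type) :
    op R T :=
  mkop (fun u v => \sum_(w : S) entry A (w, u) (w, v)).

(* Partial trace over all tensor factors but the [r]-th. *)
Definition marginal (R : realType) (I T : finType) (r : I)
    (A : op R {ffun I -> T}) : op R T :=
  mkop (fun u v => \sum_(x : {ffun I -> T} | x r == u)
    entry A x [ffun q => if q == r then v else x q]).

(* The exponential series, summed entrywise. *)
Definition expmx (R : realType) (n : nat) (A : 'M[R[i]]_n) : 'M[R[i]]_n :=
  \matrix_(i, j)
    (limn (fun m => complex.Re (\sum_(0 <= l < m) (l`!%:R)^-1 * (A ^+ l) i j))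
     +i* limn (fun m => complex.Im (\sum_(0 <= l < m) (l`!%:R)^-1 * (A ^+ l) i j)))%C.

Definition ketZ (R : realType) (s : bool) : 'cV[R[i]]_#|{: bool}| :=
  \col_i (enum_val i == s)%:R.

Definition ketX (R : realType) (s : bool) : 'cV[R[i]]_#|{: bool}| :=
  ((Num.sqrt 2)^-1)%:C%C *: (ketZ R false + (-1) ^+ s *: ketZ R true).

Definition proj (R : realType) (n : nat) (v : 'cV[R[i]]_n) : 'M[R[i]]_n :=
  v *m v ^t*.

Definition sigma_y (R : realType) : op R bool :=
  mkop (fun x y : bool => match x, y with
    | false, true => - 'i%C
    | true, false => 'i%C
    | _, _ => 0
    end).

Definition sigma_z (R : realType) : op R bool :=
  mkop (fun x y : bool => if x == y then (-1) ^+ x else 0).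

(* What the test phase does to one register: [None] if it is not tested,
   [Some (inl o)] (resp. [Some (inr o)]) if it belongs to the X (resp. Z) set
   and its two qubits give the outcomes [o.1] (client) and [o.2] (server). *)
Definition test := option (bool * bool + bool * bool).

(* The X set, the Z set and all test outcomes on [n] registers. *)
Definition test_record (n : nat) := {ffun 'I_n -> test}.

Definition Xset (n : nat) (c : test_record n) : {set 'I_n} :=
  [set r | if c r is Some (inl _) then true else false].

Definition Zset (n : nat) (c : test_record n) : {set 'I_n} :=
  [set r | if c r is Some (inr _) then true else false].

Definition fails (a : test) : bool :=
  match a with
  | Some (inl o) | Some (inr o) => o.1 != o.2
  | None => false
  end.

Definition nfail (n : nat) (c : test_record n) : nat := #|[set r | fails (c r)]|.

(* Probability of drawing the X set and then the Z set of [c]: uniform choice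
   of k registers out of 4k, then of k registers out of the remaining 3k. *)
Definition choice_prob (R : realType) (k : nat) (c : test_record (4 * k)) : R :=
  if (#|Xset c| == k) && (#|Zset c| == k)
  then ('C(4 * k, k)%:R)^-1 * ('C(3 * k, k)%:R)^-1 else 0.

Definition test_proj (R : realType) (a : test) : op R (bool * bool)%type :=
  match a with
  | None => 1%:M
  | Some (inl o) => tens2 (proj (ketX R o.1)) (proj (ketX R o.2))
  | Some (inr o) => tens2 (proj (ketZ R o.1)) (proj (ketZ R o.2))
  end.

Definition record_proj (R : realType) (n : nat) (c : test_record n) :
    op R {ffun 'I_n -> bool * bool} :=
  tens (fun r => test_proj R (c r)).

(* Joint probability of the choices and test outcomes listed in [c]. *)
Definition record_prob (R : realType) (k : nat)
    (rho : op R {ffun 'I_(4 * k) -> bool * bool}) (c : test_record (4 * k)) : R :=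
  choice_prob R c * complex.Re (\tr (record_proj R c *m rho)).

Definition post_test (R : realType) (n : nat)
    (rho : op R {ffun 'I_n -> bool * bool}) (c : test_record n) :
    op R {ffun 'I_n -> bool * bool} :=
  (\tr (record_proj R c *m rho))^-1 *: (record_proj R c *m rho *m record_proj R c).

(* State of the target register given [c]: the target is uniform among the 2k
   untested registers, and every other register is traced out. *)
Definition target_state (R : realType) (k : nat)
    (rho : op R {ffun 'I_(4 * k) -> bool * bool}) (c : test_record (4 * k)) :
    op R (bool * bool)%type :=
  ((2 * k)%:R)^-1 *: \sum_(r | c r == None) marginal r (post_test rho c).

Definition client_proj (R : realType) (s : bool) : op R (bool * bool)%type :=
  tens2 (proj (ketX R s)) (1%:M : op R bool).

Definition client_prob (R : realType) (tau : op R (bool * bool)%type) (s : bool) :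
    R[i] :=
  \tr (client_proj R s *m tau).

(* The server's qubit after the client's outcome [s]. *)
Definition server_state (R : realType) (tau : op R (bool * bool)%type) (s : bool) :
    op R bool :=
  (client_prob tau s)^-1 *:
    ptrace_fst (client_proj R s *m tau *m client_proj R s).

Definition hamiltonian (R : realType) (hbar omega : R) : op R bool :=
  (hbar * omega / 2)%:C%C *: sigma_z R.

Definition evolve (R : realType) (hbar omega t : R) (sigma : op R bool) : op R bool :=
  expmx (- ('i * (t / hbar)%:C)%C *: hamiltonian hbar omega) *m sigma
  *m expmx (('i * (t / hbar)%:C)%C *: hamiltonian hbar omega).

Definition server_effect (R : realType) (o : bool) : op R bool :=
  2^-1 *: (1%:M + (-1) ^+ (~~ o) *: sigma_y R).

(* Probability that the client records m' = s XOR o = b. *)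
Definition recorded_prob (R : realType) (hbar omega t : R)
    (tau : op R (bool * bool)%type) (b : bool) : R :=
  complex.Re (\sum_(s : bool) \sum_(o : bool | s (+) o == b)
    client_prob tau s
    * \tr (server_effect R o *m evolve hbar omega t (server_state tau s))).

(* The qubit state whose direct evolution and sigma_y measurement yields the
   outcome 1 with the probability that the client records 1 (see
   [recorded_probE]). *)
Definition sensing_state (R : realType) (tau : op R (bool * bool)%type) : op R bool :=
  \sum_(s : bool) client_prob tau s *:
    (sigma_z R ^+ s *m server_state tau s *m sigma_z R ^+ s).

Lemma sigma_zMl (R : realType) (A : op R bool) i j :
  (sigma_z R *m A) i j = (-1) ^+ (enum_val i : bool) * A i j.
Proof.
rewrite mxE (bigD1 i) //= big1 ?addr0 => [|l li]; rewrite !mxE ?eqxx //.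
by rewrite (inj_eq enum_val_inj) eq_sym (negbTE li) mul0r.
Qed.

Lemma sigma_zMr (R : realType) (A : op R bool) i j :
  (A *m sigma_z R) i j = A i j * (-1) ^+ (enum_val j : bool).
Proof.
rewrite mxE (bigD1 j) //= big1 ?addr0 => [|l li]; rewrite !mxE ?eqxx //.
by rewrite (inj_eq enum_val_inj) (negbTE li) mulr0.
Qed.

Lemma sigma_zK (R : realType) : sigma_z R *m sigma_z R = 1%:M.
Proof.
apply/matrixP => i j; rewrite sigma_zMl !mxE (inj_eq enum_val_inj).
by case: eqP => [->|]; rewrite ?mulr0 // -signr_addb addbb.
Qed.

Lemma sigma_zyz (R : realType) :
  sigma_z R *m sigma_y R *m sigma_z R = - sigma_y R.
Proof.
apply/matrixP => i j; rewrite sigma_zMr sigma_zMl !mxE.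
by case: (enum_val i); case: (enum_val j);
  rewrite /= ?expr0 ?expr1 ?mulN1r ?mulrN1 ?mul1r ?mulr1 ?oppr0 ?opprK.
Qed.

Lemma expmx_sigma_z (R : realType) (a : R[i]) :
  sigma_z R *m expmx (a *: sigma_z R) = expmx (a *: sigma_z R) *m sigma_z R.
Proof.
apply/matrixP => i j; rewrite sigma_zMl sigma_zMr.
have [->|ij] := eqVneq i j; first by rewrite mulrC.
suff -> : expmx (a *: sigma_z R) i j = 0 by rewrite mulr0 mul0r.
have H l : ((a *: sigma_z R) ^+ l) i j = 0.
  have : (sigma_z R *m (a *: sigma_z R) ^+ l) i j =
         ((a *: sigma_z R) ^+ l *m sigma_z R) i j.
    congr (fun_of_matrix _ i j); apply: commrX.
    exact: (etrans (esym (scalemxAr _ _ _)) (scalemxAl _ _ _)).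
  rewrite sigma_zMl sigma_zMr mulrC => /eqP; rewrite -subr_eq0 -mulrBr mulf_eq0.
  case/orP => [/eqP //|]; have : enum_val i != enum_val j.
    by rewrite (inj_eq enum_val_inj).
  case: (enum_val i); case: (enum_val j) => //= _;
    rewrite ?expr1 ?expr0 ?opprK.
  - by rewrite -opprD oppr_eq0 -[1 + 1]/(2%:R) pnatr_eq0.
  - by rewrite -[1 + 1]/(2%:R) pnatr_eq0.
rewrite mxE.
under eq_fun do under eq_bigr do rewrite H mulr0.
under [X in limn X]eq_fun do rewrite big1 //.
under [X in (_ +i* limn X)%C]eq_fun do under eq_bigr do rewrite H mulr0.
under [X in (_ +i* limn X)%C]eq_fun do rewrite big1 //.
by rewrite !lim_cst.
Qed.

Lemma recorded_probE (R : realType) (hbar omega t : R)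
    (tau : op R (bool * bool)%type) :
  recorded_prob hbar omega t tau true =
  complex.Re (\tr (server_effect R true *m evolve hbar omega t (sensing_state tau))).
Proof.
rewrite /recorded_prob; congr complex.Re.
rewrite /evolve /sensing_state mulmx_sumr mulmx_suml mulmx_sumr raddf_sum /=.
apply: eq_bigr => s _; rewrite (big_pred1 (~~ s)); last by case: s => -[].
move: (client_prob tau s) (server_state tau s) => p A.
have UC (a b : R[i]) : sigma_z R *m expmx (a *: (b *: sigma_z R)) =
    expmx (a *: (b *: sigma_z R)) *m sigma_z R.
  by rewrite scalerA expmx_sigma_z.
have UU := UC (- ('i * (t / hbar)%:C)%C) (hbar * omega / 2)%:C%C.
have VV := UC ('i * (t / hbar)%:C)%C (hbar * omega / 2)%:C%C.
rewrite /hamiltonian; move: UU VV.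
move: (expmx (- _ *: _)) => U; move: (expmx _) => V UU VV.
have EE : sigma_z R *m server_effect R true *m sigma_z R = server_effect R false.
  rewrite /server_effect /= expr0 expr1 -scalemxAr -scalemxAl mulmxDr mulmxDl.
  by rewrite mulmx1 sigma_zK scale1r sigma_zyz scaleN1r.
move: EE; case: s => /=; move: (server_effect R true) (server_effect R false) => E F EE.
  have -> : U *m (p *: (sigma_z R ^+ 1 *m A *m sigma_z R ^+ 1)) *m V =
      p *: (sigma_z R *m (U *m A *m V) *m sigma_z R).
    by rewrite expr1 -scalemxAr -scalemxAl !mulmxA UU -!mulmxA VV.
  rewrite -scalemxAr mxtraceZ -EE; congr (_ * _).
  by rewrite -!mulmxA [LHS]mxtrace_mulC !mulmxA.
by rewrite expr0 mul1mx mulmx1 -scalemxAr -scalemxAl -scalemxAr mxtraceZ.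
Qed.

(* The estimator applied to the recorded values [m]. *)
Definition estimator (R : realType) (M : nat) (t : R) (m : {ffun 'I_M -> bool}) : R :=
  (2 * (M%:R^-1 * \sum_j (m j)%:R) - 1) / t.

(* The client's uncertainty; the recorded values are independent given the
   target states [tau j]. *)
Definition uncertainty (R : realType) (M : nat) (hbar omega t : R)
    (tau : 'I_M -> op R (bool * bool)%type) : R :=
  Num.sqrt (\sum_(m : {ffun 'I_M -> bool})
    (\prod_j recorded_prob hbar omega t (tau j) (m j))
    * (estimator t m - omega) ^+ 2).

(* Probability of the event [E] on the test records of M independent
   repetitions. *)
Definition runs_prob (R : realType) (M k : nat)
    (rho : 'I_M -> op R {ffun 'I_(4 * k) -> bool * bool})
    (E : pred {ffun 'I_M -> test_record (4 * k)}) : R :=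
  \sum_(c | E c) \prod_j record_prob (rho j) (c j).

(* Main.v *)
(* The bound on N_fail holds for every choice of the X and Z sets, hence it
   already controls the registers that were not tested: if sigma_x tests of all
   the untested registers could give more than 2 k Delta failures, then an X set
   containing enough of the failing registers would violate the bound with
   positive probability. So a target register fails a sigma_x test with
   probability at most 2 k Delta / 2 k = Delta. This probability bounds
   <-|rho_0|->; the Bloch vector (x, y) of rho_0 in the equatorial plane thus has
   x >= 1 - 2 Delta, and x^2 + y^2 <= 1 yields
   |y| <= 2 sqrt(Delta - Delta^2) < 2 sqrt(eps - eps^2). Since
   2 P' - 1 = y cos(omega t) + x sin(omega t), the bias of the estimator is at
   most |y| / t + O(omega), and its variance is at most 1 / (M t^2). The strict
   inequality between the two square roots absorbs the O(omega) term, and the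
   conclusion even holds with probability one. *)

Require Import Defs.
From mathcomp Require Import ring lra zify.

Set Implicit Arguments.
Unset Strict Implicit.
Unset Printing Implicit Defensive.

Local Open Scope sesquilinear_scope.
Local Open Scope ring_scope.

(** * Operators by entries: products, adjoints and tensor products *)

Lemma entry_mkop (R : realType) (T : finType) (f : T -> T -> R[i]) x y :
  entry (mkop f) x y = f x y.
Proof. by rewrite /entry /mkop mxE !enum_rankK. Qed.

Lemma opP (R : realType) (T : finType) (A B : op R T) :
  (forall x y, entry A x y = entry B x y) -> A = B.
Proof.
move=> AB; apply/matrixP => i j.
by have := AB (enum_val i) (enum_val j); rewrite /entry !enum_valK.
Qed.

Lemma entryM (R : realType) (T : finType) (A B : op R T) x y :
  entry (A *m B) x y = \sum_z entry A x z * entry B z y.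
Proof.
rewrite /entry mxE (reindex (@enum_rank T)) //.
exact/onW_bij/enum_rank_bij.
Qed.

Lemma entryD (R : realType) (T : finType) (A B : op R T) x y :
  entry (A + B) x y = entry A x y + entry B x y.
Proof. by rewrite /entry mxE. Qed.

Lemma entryZ (R : realType) (T : finType) a (A : op R T) x y :
  entry (a *: A) x y = a * entry A x y.
Proof. by rewrite /entry mxE. Qed.

Lemma entry1 (R : realType) (T : finType) (x y : T) :
  entry (1%:M : op R T) x y = (x == y)%:R.
Proof. by rewrite /entry mxE (inj_eq enum_rank_inj). Qed.

Lemma adjE (R : realType) (m n : nat) (A : 'M[R[i]]_(m, n)) i j :
  (A ^t*) i j = (A j i)^*%C.
Proof. by rewrite !mxE. Qed.

Lemma entry_adj (R : realType) (T : finType) (A : op R T) x y :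
  entry (A ^t*) x y = (entry A y x)^*%C.
Proof. exact: adjE. Qed.

Lemma entry_sum (R : realType) (T J : finType) (P : pred J) (A : J -> op R T) x y :
  entry (\sum_(j | P j) A j) x y = \sum_(j | P j) entry (A j) x y.
Proof. by rewrite /entry summxE. Qed.

Lemma tr_entry (R : realType) (T : finType) (A : op R T) :
  \tr A = \sum_x entry A x x.
Proof.
rewrite /mxtrace (reindex (@enum_rank T)) //.
exact/onW_bij/enum_rank_bij.
Qed.

Lemma tr_entryM (R : realType) (T : finType) (A B : op R T) :
  \tr (A *m B) = \sum_x \sum_y entry A x y * entry B y x.
Proof. by rewrite tr_entry; apply: eq_bigr => x _; rewrite entryM. Qed.

Lemma adjM (R : realType) (m n p : nat) (A : 'M[R[i]]_(m, n)) (B : 'M[R[i]]_(n, p)) :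
  (A *m B) ^t* = B ^t* *m A ^t*.
Proof. by rewrite trmx_mul map_mxM. Qed.

Lemma adjK (R : realType) (m n : nat) (A : 'M[R[i]]_(m, n)) : (A ^t*) ^t* = A.
Proof. by apply/matrixP => i j; rewrite !adjE conjcK. Qed.

Lemma adj1 (R : realType) (n : nat) : (1%:M : 'M[R[i]]_n) ^t* = 1%:M.
Proof. by rewrite trmx1 map_mx1. Qed.

Lemma tensM (R : realType) (I T : finType) (A B : I -> op R T) :
  tens A *m tens B = tens (fun i => A i *m B i).
Proof.
apply: opP => x y; rewrite entryM entry_mkop.
under [RHS]eq_bigr do rewrite entryM.
rewrite bigA_distr_bigA; apply: eq_bigr => z _.
by rewrite !entry_mkop -big_split.
Qed.

Lemma tens_adj (R : realType) (I T : finType) (A : I -> op R T) :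
  (tens A) ^t* = tens (fun i => (A i) ^t*).
Proof.
apply: opP => x y; rewrite entry_adj !entry_mkop.
rewrite (rmorph_prod (@conjc R)).
by apply: eq_bigr => i _; rewrite entry_adj.
Qed.

Lemma tens1 (R : realType) (I T : finType) :
  tens (fun=> 1%:M) = 1%:M :> op R {ffun I -> T}.
Proof.
apply: opP => x y; rewrite entry_mkop entry1.
have [->|/eqP xy] := eqVneq x y; first by rewrite big1 // => i _; rewrite entry1 eqxx.
have [i xyi] : exists i, x i != y i.
  apply/existsP; rewrite -negb_forall; apply/negP => /forallP H.
  by apply: xy; apply/ffunP => i; apply/eqP.
by rewrite (bigD1 i) //= entry1 (negbTE xyi) mul0r.
Qed.

(** Distributivity of products over sums, entrywise. It collapses a sum over a product-shaped set of
    test records into a single tensor product. *)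
Lemma tens_sum (R : realType) (I T J : finType) (Q : I -> pred J)
    (F : I -> J -> op R T) :
  tens (fun i => \sum_(j | Q i j) F i j) =
  \sum_(f in family Q) tens (fun i => F i (f i)).
Proof.
apply: opP => x y; rewrite entry_mkop entry_sum.
under eq_bigr do rewrite entry_sum.
rewrite bigA_distr_big_dep; apply: eq_bigr => f _.
by rewrite entry_mkop.
Qed.

Lemma eq_tens (R : realType) (I T : finType) (A B : I -> op R T) :
  A =1 B -> tens A = tens B.
Proof.
move=> AB; apply: opP => x y; rewrite !entry_mkop.
by apply: eq_bigr => i _; rewrite AB.
Qed.

Lemma tens2M (R : realType) (S T : finType) (A A' : op R S) (B B' : op R T) :
  tens2 A B *m tens2 A' B' = tens2 (A *m A') (B *m B').
Proof.
apply: opP => x y; rewrite entryM entry_mkop !entryM big_distrlr /=.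
rewrite pair_bigA /=; apply: eq_bigr => z _.
by rewrite !entry_mkop mulrACA.
Qed.

Lemma tens2_adj (R : realType) (S T : finType) (A : op R S) (B : op R T) :
  (tens2 A B) ^t* = tens2 (A ^t*) (B ^t*).
Proof.
by apply: opP => x y; rewrite entry_adj !entry_mkop rmorphM !entry_adj.
Qed.

Lemma tens2Dl (R : realType) (S T : finType) (A A' : op R S) (B : op R T) :
  tens2 (A + A') B = tens2 A B + tens2 A' B.
Proof. by apply: opP => x y; rewrite entryD !entry_mkop entryD mulrDl. Qed.

Lemma tens2_11 (R : realType) (S T : finType) :
  tens2 (1%:M : op R S) (1%:M : op R T) = 1%:M.
Proof.
apply: opP => x y; rewrite entry_mkop !entry1 -natrM mulnb.
by case: x y => [? ?] [? ?]; rewrite xpair_eqE.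
Qed.

(** * Partial traces and positivity *)

(** Partial trace is dual to padding with identities. All later facts on [marginal] go through this
    duality rather than through entries. *)
Lemma tr_marginal (R : realType) (I T : finType) (r : I) (B : op R T)
    (A : op R {ffun I -> T}) :
  \tr (B *m marginal r A) = \tr (tens (fun q => if q == r then B else 1%:M) *m A).
Proof.
rewrite tr_entryM tr_entryM exchange_big /=.
transitivity (\sum_u \sum_(x : {ffun I -> T} | x r == u) \sum_v
    entry B v (x r) * entry A x [ffun q => if q == r then v else x q]).
  apply: eq_bigr => u _; rewrite exchange_big /=.
  apply: eq_bigr => v _; rewrite entry_mkop big_distrr /=.
  by apply: eq_bigr => x /eqP <-.
rewrite [RHS]exchange_big /=.
rewrite (partition_big (fun x : {ffun I -> T} => x r) predT) //=.
apply: eq_bigr => u _; apply: eq_bigr => x _.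
rewrite (partition_big (fun y : {ffun I -> T} => y r) predT) //=.
apply: eq_bigr => v _.
(* Among the [y] with value [v] at [r], the identity factors keep only the one that agrees with [x]
   elsewhere. *)
rewrite (bigD1 [ffun q => if q == r then v else x q]) /=; last by rewrite ffunE eqxx.
rewrite big1 ?addr0 => [|y /andP[/eqP yr /eqP yx]].
  rewrite entry_mkop (bigD1 r) //= !ffunE eqxx big1 ?mulr1 // => q /negbTE qr.
  by rewrite qr entry1 ffunE qr eqxx.
have [q /andP[qr yxq]] : exists q, (q != r) && (y q != x q).
  apply/existsP; rewrite -[X in is_true X]negbK negb_exists; apply/negP => /forallP H.
  apply: yx; apply/ffunP => q; rewrite ffunE; case: eqVneq => [->|qr] //.
  by move: (H q); rewrite qr /= negbK => /eqP.
by rewrite entry_mkop (bigD1 q) //= (negbTE qr) entry1 (negbTE yxq) !mul0r.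
Qed.

Lemma tr_ptrace_fst (R : realType) (S T : finType) (B : op R T) (A : op R (S * T)%type) :
  \tr (B *m ptrace_fst A) = \tr (tens2 1%:M B *m A).
Proof.
rewrite !tr_entryM.
transitivity (\sum_u \sum_v \sum_w entry B u v * entry A (w, v) (w, u)).
  by apply: eq_bigr => u _; apply: eq_bigr => v _; rewrite entry_mkop big_distrr.
transitivity (\sum_w \sum_u \sum_v entry B u v * entry A (w, v) (w, u)).
  by rewrite [RHS]exchange_big /=; apply: eq_bigr => u _; rewrite exchange_big.
rewrite pair_bigA /=; apply: eq_bigr => -[w u] _ /=.
transitivity (\sum_w' \sum_v entry (tens2 1%:M B) (w, u) (w', v) *
    entry A (w', v) (w, u)); last first.
  by rewrite pair_bigA; apply: eq_bigr => -[].
rewrite (bigD1 w) //= [X in _ = _ + X]big1 ?addr0.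
  by apply: eq_bigr => v _; rewrite entry_mkop entry1 eqxx mul1r.
move=> w' /negbTE ww; rewrite big1 // => v _.
by rewrite entry_mkop entry1 eq_sym ww !mul0r.
Qed.

(* Positivity as a functional on operators, so that partial traces are handled
   by duality. *)
Definition psd (R : realType) (T : finType) (rho : op R T) : Prop :=
  forall A : op R T, 0 <= \tr (A ^t* *m A *m rho).

Definition projection (R : realType) (T : finType) (P : op R T) : Prop :=
  P ^t* = P /\ P *m P = P.

Lemma psd_projection (R : realType) (T : finType) (rho P : op R T) :
  psd rho -> projection P -> 0 <= \tr (P *m rho).
Proof. by move=> rho_ge0 [Pa PP]; have := rho_ge0 P; rewrite Pa PP. Qed.

Lemma psd_compress (R : realType) (T : finType) (rho P : op R T) :
  psd rho -> P ^t* = P -> psd (P *m rho *m P).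
Proof.
move=> rho_ge0 Pa A; have := rho_ge0 (A *m P).
by rewrite adjM Pa !mulmxA [X in _ -> 0 <= X]mxtrace_mulC !mulmxA.
Qed.

(** By cyclicity the trace is that of [A *m rho *m A ^t*], whose diagonal entries are values of the
    quadratic form of [rho] at the adjoints of the rows of [A]. *)
Lemma density_psd (R : realType) (T : finType) (rho : op R T) :
  density rho -> psd rho.
Proof.
move=> [_ rho_ge0 _] A; rewrite -mulmxA mxtrace_mulC.
rewrite /mxtrace sumr_ge0 // => i _.
have := rho_ge0 ((row i A) ^t*); rewrite adjK.
suff -> : (row i A *m rho *m (row i A) ^t*) 0 0 = (A *m rho *m A ^t*) i i by [].
rewrite -row_mul !mxE; apply: eq_bigr => l _; congr (_ * _); first by rewrite !mxE.
by rewrite !mxE.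
Qed.

Lemma tens_projection (R : realType) (I T : finType) (P : I -> op R T) :
  (forall i, projection (P i)) -> projection (tens P).
Proof.
move=> H; split; rewrite ?tens_adj ?tensM; apply: eq_tens => i; by case: (H i).
Qed.

Lemma tens2_projection (R : realType) (S T : finType) (P : op R S) (Q : op R T) :
  projection P -> projection Q -> projection (tens2 P Q).
Proof. by move=> [Pa PP] [Qa QQ]; split; rewrite ?tens2_adj ?tens2M ?Pa ?PP ?Qa ?QQ. Qed.

Lemma projection1 (R : realType) (T : finType) : projection (1%:M : op R T).
Proof. by split; rewrite ?adj1 ?mul1mx. Qed.

Lemma psd_marginal (R : realType) (I T : finType) (r : I) (A : op R {ffun I -> T}) :
  psd A -> psd (marginal r A).
Proof.
move=> A_ge0 B; rewrite tr_marginal.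
have := A_ge0 (tens (fun q => if q == r then B else 1%:M)).
rewrite tens_adj tensM; congr (0 <= \tr (_ *m _)).
by apply: eq_tens => q; case: ifP; rewrite ?adj1 ?mul1mx.
Qed.

Lemma psdZ (R : realType) (T : finType) (a : R[i]) (A : op R T) :
  0 <= a -> psd A -> psd (a *: A).
Proof. by move=> a0 A0 B; rewrite -scalemxAr mxtraceZ mulr_ge0. Qed.

Lemma psd_sum (R : realType) (T J : finType) (P : pred J) (A : J -> op R T) :
  (forall j, P j -> psd (A j)) -> psd (\sum_(j | P j) A j).
Proof.
by move=> A0 B; rewrite mulmx_sumr raddf_sum /=; apply: sumr_ge0 => j Pj; apply: A0.
Qed.

(** * Pauli Z and the projectors of the two measurement bases *)

Lemma entry_sigma_z (R : realType) x y :
  entry (sigma_z R) x y = if x == y then (-1) ^+ x else 0.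
Proof. exact: entry_mkop. Qed.

Lemma entry_proj_ketX (R : realType) s x y :
  entry (proj (ketX R s)) x y = 2^-1 * (-1) ^+ (s && (x (+) y)).
Proof.
have K u : ketX R s (enum_rank u) 0 = ((Num.sqrt 2)^-1)%:C%C * (-1) ^+ (s && u).
  by rewrite !mxE !enum_rankK; case: u; case: s;
    rewrite /= !(expr0, expr1, mulr0, mulr1, addr0, add0r).
rewrite /entry /proj mxE big_ord_recl big_ord0 addr0 adjE !K.
have -> (a : R) (b : bool) : (a%:C * (-1) ^+ b)^*%C = a%:C%C * (-1) ^+ b.
  rewrite -(rmorph_sign (real_complex R)) -(rmorphM (real_complex R)).
  exact: conjc_real.
rewrite mulrACA -rmorphM /= -invfM -expr2 sqr_sqrtr ?ler0n // -signr_addb.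
congr (_ * _); first by rewrite fmorphV rmorph_nat.
by case: {K} s; case: x; case: y.
Qed.

Lemma entry_proj_ketZ (R : realType) s x y :
  entry (proj (ketZ R s)) x y = ((x == s) && (y == s))%:R.
Proof.
rewrite /entry /proj mxE big_ord_recl big_ord0 addr0 adjE !mxE !enum_rankK.
by rewrite (rmorph_nat (@conjc R)) -natrM mulnb.
Qed.

Lemma half_add (R : realType) : 2^-1 + 2^-1 = 1 :> R[i].
Proof. by rewrite [RHS](splitr 1) div1r. Qed.

Lemma sum_proj_ketX (R : realType) : \sum_s proj (ketX R s) = 1%:M :> op R bool.
Proof.
apply: opP => x y; rewrite (entry_sum predT (fun s => proj (ketX R s))).
under eq_bigr do rewrite entry_proj_ketX.
rewrite entry1 big_bool.
by case: x; case: y; rewrite /= !(expr0, expr1, mulr1, mulrN1) ?subrr ?addNr ?half_add.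
Qed.

Lemma sum_proj_ketZ (R : realType) : \sum_s proj (ketZ R s) = 1%:M :> op R bool.
Proof.
apply: opP => x y; rewrite (entry_sum predT (fun s => proj (ketZ R s))).
under eq_bigr do rewrite entry_proj_ketZ.
rewrite entry1 big_bool.
by case: x; case: y => /=; rewrite ?addr0 ?add0r.
Qed.

Lemma proj_ketX_projection (R : realType) s : projection (proj (ketX R s) : op R bool).
Proof.
split; apply: opP => x y.
  rewrite entry_adj !entry_proj_ketX rmorphM rmorph_sign fmorphV rmorph_nat.
  by rewrite addbC.
rewrite entryM; under eq_bigr do rewrite !entry_proj_ketX mulrACA -signr_addb.
rewrite entry_proj_ketX -mulr_sumr big_bool /= -mulrA; congr (_ * _).
case: s; case: x; case: y;
  rewrite /= !(expr0, expr1) -?opprD ?addrN ?addNr ?mulr0 ?mulrN ?mulrDr ?mulr1;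
  rewrite ?half_add //.
Qed.

Lemma proj_ketZ_projection (R : realType) s : projection (proj (ketZ R s) : op R bool).
Proof.
split; apply: opP => x y.
  by rewrite entry_adj !entry_proj_ketZ rmorph_nat andbC.
rewrite entryM; under eq_bigr do rewrite !entry_proj_ketZ -natrM.
rewrite entry_proj_ketZ big_bool /= -natrD.
by case: s; case: x; case: y.
Qed.

(** [sigma_z] exchanges |+> and |->, so the correction by [s] acts on X outcomes as an exclusive
    or. *)
Lemma sigma_z_conj_ketX (R : realType) (s b : bool) :
  sigma_z R ^+ s *m proj (ketX R b) *m sigma_z R ^+ s =
  proj (ketX R (s (+) b)).
Proof.
case: s; last by rewrite expr0 mul1mx mulmx1.
rewrite expr1; apply: opP => x y; rewrite /entry sigma_zMr sigma_zMl !enum_rankK.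
rewrite -!/(entry _ _ _) !entry_proj_ketX.
by case: x; case: y; case: b;
  rewrite /= !(expr0, expr1, mulr1, mul1r, mulrN1, mulN1r, opprK).
Qed.

(** * Time evolution under the Hamiltonian *)

Lemma sum_complex (R : realType) (J : Type) (s : seq J) (P : pred J) (a b : J -> R) :
  \sum_(j <- s | P j) (a j +i* b j)%C =
  ((\sum_(j <- s | P j) a j) +i* (\sum_(j <- s | P j) b j))%C.
Proof.
elim: s => [|j s IHs]; first by rewrite !big_nil.
by rewrite !big_cons IHs; case: (P j).
Qed.

(** Euler's formula term by term: writing [l] as its parity plus twice its half turns the even
    powers of the imaginary unit into signs and leaves one factor of it exactly when [l] is odd. *)
Lemma exp_coeff_imaginary (R : realType) (x : R) (l : nat) :
  (l`!%:R)^-1 * ('i * x%:C)%C ^+ l = (cos_coeff x l +i* sin_coeff x l)%C.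
Proof.
rewrite -[l in _ ^+ l]odd_double_half exprMn exprD -mul2n exprM sqr_i.
rewrite -rmorphXn /= mul2n odd_double_half.
have -> : (-1 : R[i]) ^+ l./2 = ((-1) ^+ l./2 : R)%:C%C by rewrite rmorphXn rmorphN1.
have -> : (l`!%:R : R[i])^-1 = ((l`!%:R)^-1 : R)%:C%C by rewrite fmorphV rmorph_nat.
rewrite /cos_coeff /sin_coeff /= -exprnP.
(* [sin_coeff] takes its sign from [l.-1./2] instead of [l./2]. *)
have half_pred : odd l -> l.-1./2 = l./2 by lia.
move: half_pred; case: (odd l) => [->|_] //; rewrite /= !(expr0, expr1, mul0r, mul1r);
  move: ((-1) ^+ _) (x ^+ l) (_^-1) => p q r; simpc;
  rewrite ?(mulr0, mul0r, addr0, subr0);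
  congr (_ +i* _)%C; ring.
Qed.

Lemma expmx_imaginary_sigma_z (R : realType) (x : R) (u v : bool) :
  entry (expmx (('i * x%:C)%C *: sigma_z R)) u v =
  if u == v then (cos ((-1) ^+ u * x) +i* sin ((-1) ^+ u * x))%C else 0.
Proof.
have pow l : entry ((('i * x%:C)%C *: sigma_z R) ^+ l) u v =
    if u == v then ('i * ((-1) ^+ u * x)%:C)%C ^+ l else 0.
  elim: l u v => [|l IHl] u v; first by rewrite !expr0 entry1; case: eqP.
  rewrite !exprS entryM (bigD1 u) //= big1 => [|w wu].
    rewrite addr0 IHl entryZ entry_sigma_z eqxx; case: eqP => _; last by rewrite mulr0.
    congr (_ * _); rewrite -mulrA; congr (_ * _).
    by rewrite (rmorphM (real_complex R)) /= (rmorph_sign (real_complex R)) mulrC.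
  by rewrite entryZ entry_sigma_z eq_sym (negbTE wu) mulr0 mul0r.
have sum m : \sum_(0 <= l < m) (l`!%:R)^-1 *
    ((('i * x%:C)%C *: sigma_z R) ^+ l) (enum_rank u) (enum_rank v) =
    if u == v then (series (cos_coeff ((-1) ^+ u * x)) m +i*
      series (sin_coeff ((-1) ^+ u * x)) m)%C else 0.
  case: eqP => uv; last first.
    rewrite big1 // => l _.
    by have := pow l; rewrite /entry => ->; case: eqP => // _; rewrite mulr0.
  rewrite -sum_complex; apply: eq_bigr => l _; rewrite -exp_coeff_imaginary.
  by have := pow l; rewrite /entry => ->; case: eqP.
rewrite /entry mxE; under eq_fun do rewrite sum.
under [X in (_ +i* limn X)%C]eq_fun do rewrite sum.
case: eqP => uv /=; first by rewrite [in RHS]unlock [in sin _]unlock.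
by rewrite !lim_cst.
Qed.

(** Each exponential contributes phases of angle [y = omega * t / 2] up to sign. Off the diagonal
    they add up to [omega * t]; on the diagonal they cancel, which preserves the trace. *)
Lemma evolve_phase (R : realType) (hbar omega t : R) (A : op R bool) :
  hbar != 0 ->
  [/\ entry (evolve hbar omega t A) false true =
         (cos (omega * t) -i* sin (omega * t))%C * entry A false true,
      entry (evolve hbar omega t A) true false =
         (cos (omega * t) +i* sin (omega * t))%C * entry A true false
    & \tr (evolve hbar omega t A) = \tr A].
Proof.
move=> hbar0; set y := omega * t / 2.
have omegat : omega * t = y + y by rewrite -splitr.
have U : - ('i * (t / hbar)%:C)%C *: hamiltonian hbar omega =
    ('i * (- y)%:C)%C *: sigma_z R.
  rewrite /hamiltonian scalerA; congr (_ *: _).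
  rewrite -mulNr -mulrA -mulrN mulNr -mulrN; congr (_ * _).
  rewrite -(rmorphM (real_complex R)) -(rmorphN (real_complex R)) /=.
  by congr (_%:C)%C; rewrite /y; field.
have V : ('i * (t / hbar)%:C)%C *: hamiltonian hbar omega =
    ('i * y%:C)%C *: sigma_z R.
  rewrite /hamiltonian scalerA -mulrA; congr (_ * _ *: _).
  rewrite -(rmorphM (real_complex R)) /=.
  by congr (_%:C)%C; rewrite /y; field.
have E u v : entry (evolve hbar omega t A) u v =
    (cos (- ((-1) ^+ u * y)) +i* sin (- ((-1) ^+ u * y)))%C * entry A u v *
    (cos ((-1) ^+ v * y) +i* sin ((-1) ^+ v * y))%C.
  rewrite /evolve U V entryM (bigD1 v) //= big1 ?addr0 => [|w wv]; last first.
    by rewrite expmx_imaginary_sigma_z (negbTE wv) mulr0.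
  rewrite expmx_imaginary_sigma_z eqxx; congr (_ * _).
  rewrite entryM (bigD1 u) //= big1 ?addr0 => [|w wu]; last first.
    by rewrite expmx_imaginary_sigma_z eq_sym (negbTE wu) mul0r.
  by rewrite expmx_imaginary_sigma_z eqxx mulrN.
have P u : (cos (- ((-1) ^+ u * y)) +i* sin (- ((-1) ^+ u * y)))%C *
    (cos ((-1) ^+ u * y) +i* sin ((-1) ^+ u * y))%C = 1.
  rewrite cosN sinN; move: (cos2Dsin2 ((-1) ^+ u * y)).
  move: (cos _) (sin _) => c s cs; simpc.
  by rewrite -!expr2 cs [s * c]mulrC subrr.
split.
- rewrite E /= expr0 expr1 mul1r mulN1r mulrAC cosN sinN omegat cosD sinD.
  by congr (_ * _); simpc; congr (_ +i* _)%C; ring.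
- rewrite E /= expr0 expr1 mul1r mulN1r mulrAC opprK omegat cosD sinD.
  by congr (_ * _); simpc; congr (_ +i* _)%C; ring.
rewrite !tr_entry; apply: eq_bigr => u _.
by rewrite E mulrAC P mul1r.
Qed.

(** * The Bloch vector of a qubit *)

Lemma psd_quadratic (R : realType) (rho : op R bool) (z w : R[i]) : psd rho ->
  0 <= z^*%C * z * entry rho false false + z^*%C * w * entry rho true false
     + (w^*%C * z * entry rho false true + w^*%C * w * entry rho true true).
Proof.
move=> rho_ge0; pose u (b : bool) := if b then w else z.
(* The vector becomes the only nonzero row of [A], so that [A ^t* *m A] has rank at most one. *)
pose A : op R bool := mkop (fun x y : bool => if x then 0 else u y).
have -> : z^*%C * z * entry rho false false + z^*%C * w * entry rho true false
     + (w^*%C * z * entry rho false true + w^*%C * w * entry rho true true) =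
    \tr (A ^t* *m A *m rho); last exact: rho_ge0.
have E x y : entry (A ^t* *m A) x y = (u x)^*%C * u y.
  by rewrite entryM big_bool /= !entry_adj !entry_mkop /= mulr0 add0r.
rewrite tr_entryM; under eq_bigr do under eq_bigr do rewrite E.
rewrite !big_bool /= [RHS]addrC.
by congr (_ + _); rewrite addrC.
Qed.

(** Up to sign, [2 * a] and [2 * b] are the equatorial coordinates of the Bloch vector; the
    inequality places them in the unit disc. *)
Lemma psd_qubit (R : realType) (rho : op R bool) : psd rho -> \tr rho = 1 ->
  exists a b : R, [/\ entry rho false true = (a +i* b)%C,
    entry rho true false = (a -i* b)%C & 4 * (a ^+ 2 + b ^+ 2) <= 1].
Proof.
move=> rho_ge0; rewrite tr_entry big_bool /=.
have := psd_quadratic _ _ rho_ge0.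
case: (entry rho false false) => p p'; case: (entry rho true true) => q q'.
case: (entry rho false true) => a b; case: (entry rho true false) => c d.
move=> H [pq pq'].
have Hre (z z' w w' : R) := H (z +i* z')%C (w +i* w')%C.
(* Real values of the form at (1, 0), (0, 1), (1, 1) and (1, i) make [rho] Hermitian. *)
have := Hre 1 0 0 0; simpc.
case/andP => /eqP p'0 p0.
have := Hre 0 0 1 0; simpc.
case/andP => /eqP q'0 q0.
have := Hre 1 0 1 0; simpc; case/andP => /eqP h1 _.
have := Hre 1 0 0 1; simpc; case/andP => /eqP h2 _.
have bd : d = - b by lra.
have ac : c = a by lra.
exists a, b; split; rewrite ?bd ?ac //.
have [->|r0] := eqVneq (a ^+ 2 + b ^+ 2) 0; first by rewrite mulr0.
pose r := Num.sqrt (a ^+ 2 + b ^+ 2).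
have s0 : 0 <= a ^+ 2 + b ^+ 2 by rewrite addr_ge0 // sqr_ge0.
have rr : r ^+ 2 = a ^+ 2 + b ^+ 2 by rewrite sqr_sqrtr.
have rp : 0 < r by rewrite sqrtr_gt0 lt0r r0.
(* With [r] the modulus of the off-diagonal entry and trace 1, the form at this vector equals
   [r ^+ 2 * (1 - 2 * r)]. *)
have := Hre r 0 (- a) (- b); simpc; case/andP => _; rewrite ?bd ?ac => h.
have {}h : 0 <= r ^+ 2 * p - 2 * r * (a ^+ 2 + b ^+ 2) + (a ^+ 2 + b ^+ 2) * q by lra.
have {}h : 0 <= 1 - 2 * r.
  have : 0 <= r ^+ 2 * (1 - 2 * r).
    by move: h; rewrite -rr (_ : q = 1 - p); lra.
  by rewrite pmulr_rge0 // exprn_gt0.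
rewrite -rr; nra.
Qed.

(** * The sensing state and the recorded probability *)

(** The weight [client_prob tau s] cancels the normalisation in [server_state] only where it is
    nonzero, hence the restricted sum. Cyclicity then moves the corrections onto [B]. *)
Lemma tr_sensing_state (R : realType) (tau : op R (bool * bool)%type) (B : op R bool) :
  \tr (B *m sensing_state tau) =
  \sum_(s | client_prob tau s != 0)
    \tr (tens2 (proj (ketX R s)) (sigma_z R ^+ s *m B *m sigma_z R ^+ s) *m tau).
Proof.
rewrite /sensing_state mulmx_sumr raddf_sum /= [RHS]big_mkcond.
apply: eq_bigr => s _; rewrite -scalemxAr mxtraceZ /server_state.
rewrite -scalemxAr -scalemxAl -scalemxAr mxtraceZ mulrA.
have [->|p0] := eqVneq (client_prob tau s) 0; first by rewrite mul0r mul0r.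
rewrite mulfV // mul1r; set S := sigma_z R ^+ s; set P := client_proj R s.
rewrite mulmxA mxtrace_mulC !mulmxA tr_ptrace_fst mulmxA mxtrace_mulC !mulmxA.
have [_ PP] := proj_ketX_projection R s.
by rewrite /P /client_proj !tens2M !mulmx1 PP mul1mx.
Qed.

Lemma le_Re (R : realType) (x y : R[i]) : x <= y -> complex.Re x <= complex.Re y.
Proof. by rewrite lecE => /andP[]. Qed.

(** The probability that an X test of the target register would fail. *)
Definition mismatch_x (R : realType) (tau : op R (bool * bool)%type) : R :=
  complex.Re (\sum_(o : bool * bool | o.1 != o.2)
    \tr (tens2 (proj (ketX R o.1)) (proj (ketX R o.2)) *m tau)).

Lemma psd_sensing_state (R : realType) (tau : op R (bool * bool)%type) :
  psd tau -> psd (sensing_state tau).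
Proof.
move=> tau_ge0 A; rewrite tr_sensing_state; apply: sumr_ge0 => s _.
have [Pa PP] := proj_ketX_projection R s.
have := tau_ge0 (tens2 (proj (ketX R s)) (A *m sigma_z R ^+ s)).
rewrite tens2_adj tens2M Pa PP adjM.
suff -> : (sigma_z R ^+ s) ^t* = sigma_z R ^+ s by rewrite !mulmxA.
case: (s); rewrite ?expr1 ?expr0 ?adj1 //.
apply: opP => x y; rewrite entry_adj !entry_sigma_z eq_sym.
by case: eqP => [->|_]; rewrite ?rmorph_sign ?rmorph0.
Qed.

Lemma sum_client_prob (R : realType) (tau : op R (bool * bool)%type) :
  \sum_s client_prob tau s = \tr tau.
Proof.
rewrite /client_prob -raddf_sum -mulmx_suml /=; congr (\tr _).
rewrite -[RHS]mul1mx; congr (_ *m _).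
by rewrite -tens2_11 -[X in _ = tens2 X _]sum_proj_ketX !big_bool tens2Dl.
Qed.

Lemma tr_sensing_state1 (R : realType) (tau : op R (bool * bool)%type) :
  \tr tau = 1 -> \tr (sensing_state tau) = 1.
Proof.
move=> tau1; rewrite -[sensing_state tau]mul1mx tr_sensing_state.
transitivity (\sum_s client_prob tau s).
  rewrite [LHS]big_mkcond; apply: eq_bigr => s _; case: ifPn => [_|/negPn/eqP->] //.
  rewrite mulmx1 /client_prob /client_proj; congr (\tr (tens2 _ _ *m _)).
  by case: s; rewrite ?expr0 ?mul1mx // expr1 sigma_zK.
by rewrite sum_client_prob.
Qed.

(* The correction sigma_z^s turns |-> into the sigma_x eigenvector of outcome 1 - s. *)
Lemma sensing_state_minus (R : realType) (tau : op R (bool * bool)%type) :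
  psd tau ->
  complex.Re (\tr (proj (ketX R true) *m sensing_state tau)) <= mismatch_x tau.
Proof.
move=> tau_ge0; rewrite tr_sensing_state /mismatch_x.
have term_ge0 (o : bool * bool) :
    0 <= \tr (tens2 (proj (ketX R o.1)) (proj (ketX R o.2)) *m tau).
  apply: psd_projection => //; apply: tens2_projection;
    apply: proj_ketX_projection.
rewrite big_mkcond [leRHS](_ : _ = complex.Re (\sum_s
    \tr (tens2 (proj (ketX R s)) (proj (ketX R (~~ s))) *m tau))); last first.
  rewrite big_mkcond -(pair_bigA _ (fun s s' => if s != s' then
    \tr (tens2 (proj (ketX R s)) (proj (ketX R s')) *m tau) else 0)) /=.
  congr complex.Re; apply: eq_bigr => s _; rewrite big_bool /=.
  by case: s; rewrite /= ?add0r ?addr0.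
apply: le_Re; apply: ler_sum => s _; case: ifP => _; last exact: (term_ge0 (s, _)).
by rewrite sigma_z_conj_ketX addbT.
Qed.

(** If [a +i* b] is the off-diagonal entry of the sensing state, the quantity to bound is [2 * a *
    sin (omega * t) - 2 * b * cos (omega * t)]. The disc bound gives [2 * a] modulus at most 1, and
    the mismatch bound makes [b] small by forcing [a] to be large. *)
Lemma recorded_prob_true (R : realType) (hbar omega t eta : R)
    (tau : op R (bool * bool)%type) :
  hbar != 0 -> psd tau -> \tr tau = 1 -> mismatch_x tau <= eta -> eta <= 1 / 2 ->
  `|2 * recorded_prob hbar omega t tau true - 1| <=
  2 * Num.sqrt (eta - eta ^+ 2) + `|sin (omega * t)|.
Proof.
move=> hbar0 tau_ge0 tau1 mis eta2.
have trs := tr_sensing_state1 tau1.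
have [a [b [e01 e10 ab]]] := psd_qubit (psd_sensing_state tau_ge0) trs.
(* The population of |-> in the sensing state is [1 / 2 - a]. *)
have a_ge : 1 - 2 * eta <= 2 * a.
  have := le_trans (sensing_state_minus tau_ge0) mis.
  move: trs; rewrite tr_entry tr_entryM !big_bool /=.
  rewrite !entry_proj_ketX /= e01 e10.
  case: (entry _ _ _) => p p'; case: (entry _ _ _) => q q' [pq _].
  have -> : 2^-1 = (2^-1 : R)%:C%C by rewrite fmorphV rmorph_nat.
  rewrite !(expr0, expr1, mulr1, mulrN1) /= !(mul0r, mulr0, oppr0, subr0); lra.
have b_le : `|2 * b| <= 2 * Num.sqrt (eta - eta ^+ 2).
  rewrite normrM ger0_norm // ler_pM2l // -sqrtr_sqr; apply: ler_wsqrtr.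
  (* Squaring is monotone here because [eta <= 1 / 2]; what the disc leaves for [4 * b ^+ 2] is then
     at most [1 - (1 - 2 * eta) ^+ 2]. *)
  have : (1 - 2 * eta) ^+ 2 <= (2 * a) ^+ 2.
    by rewrite lerXn2r ?nnegrE; move: a_ge eta2; clear; lra.
  by move: ab; clear; lra.
have -> : 2 * recorded_prob hbar omega t tau true - 1 =
    2 * a * sin (omega * t) - 2 * b * cos (omega * t).
  rewrite recorded_probE.
  have [E01 E10 Etr] := evolve_phase omega t (sensing_state tau) hbar0.
  rewrite /server_effect /= expr0 scale1r -scalemxAl mxtraceZ mulmxDl mul1mx.
  rewrite raddfD /= Etr trs tr_entryM !big_bool /= !entry_mkop /= !mul0r add0r addr0.
  rewrite E01 E10 e01 e10.
  have -> : 2^-1 = (2^-1 : R)%:C%C by rewrite fmorphV rmorph_nat.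
  move: (cos _) (sin _) => c s /=; simpc; lra.
rewrite addrC (le_trans (ler_normD _ _)) // lerD //.
  rewrite normrN normrM (le_trans _ b_le) // ler_piMr // ler_norml cos_le1 andbT.
  exact: cos_geN1.
rewrite normrM ler_piMl // ler_norml; nra.
Qed.

(** The server's two effects sum to the identity and evolution keeps the trace, so each [s]
    contributes all of its [client_prob]. *)
Lemma recorded_prob_false (R : realType) (hbar omega t : R)
    (tau : op R (bool * bool)%type) :
  hbar != 0 -> \tr tau = 1 ->
  recorded_prob hbar omega t tau false = 1 - recorded_prob hbar omega t tau true.
Proof.
move=> hbar0 tau1; apply/eqP; rewrite eq_sym subr_eq eq_sym; apply/eqP.
rewrite /recorded_prob -(raddfD (@complex.Re R : Rcomplex R -> R)) /=.
transitivity (complex.Re (\sum_s client_prob tau s));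
  last by rewrite sum_client_prob tau1.
congr complex.Re.
rewrite -big_split /=; apply: eq_bigr => s _.
rewrite (big_pred1 s); last by case: (s) => -[].
rewrite (big_pred1 (~~ s)); last by case: (s) => -[].
(* An outcome of probability zero has no normalised server state, but its contribution is zero on
   both sides. *)
have [->|p0] := eqVneq (client_prob tau s) 0; first by rewrite !mul0r addr0.
rewrite -mulrDr -raddfD -mulmxDl /=.
have -> : server_effect R s + server_effect R (~~ s) = 1%:M.
  have -> : 1%:M = 2^-1 *: (1%:M + 1%:M) :> op R bool.
    by rewrite scalerDr -scalerDl half_add scale1r.
  rewrite -scalerDr; congr (_ *: _).
  rewrite addrACA -scalerDl (_ : (-1) ^+ _ + _ = 0) ?scale0r ?addr0 //.
  by case: (s); rewrite /= expr0 expr1 ?subrr ?addNr.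
rewrite mul1mx; have [_ _ ->] := evolve_phase omega t (server_state tau s) hbar0.
rewrite /server_state mxtraceZ -[ptrace_fst _]mul1mx tr_ptrace_fst tens2_11 mul1mx.
rewrite mxtrace_mulC mulmxA tens2M.
have [_ ->] := proj_ketX_projection R s.
by rewrite mul1mx mulVf ?mulr1.
Qed.

(** * Weights of test records and their refinement *)

Lemma test_proj_projection (R : realType) (a : test) : projection (test_proj R a).
Proof.
case: a => [[u|u]|] /=; last exact: projection1.
  by apply: tens2_projection; apply: proj_ketX_projection.
by apply: tens2_projection; apply: proj_ketZ_projection.
Qed.

(** The role of a register with its outcomes forgotten: [Some false] stands for the X set,
    [Some true] for the Z set. *)
Definition kind (a : test) : option bool :=
  match a with
  | None => None
  | Some (inl _) => Some false
  | Some (inr _) => Some true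
  end.

Lemma big_kind_x (V : nmodType) (P : pred test) (F : test -> V) :
  \sum_(a | (kind a == Some false) && P a) F a =
  \sum_(o | P (Some (inl o))) F (Some (inl o)).
Proof.
rewrite (reindex_omap (fun o => Some (inl o))
  (fun a : test => if a is Some (inl o) then Some o else None)).
  by apply: eq_bigl => o /=; rewrite eqxx andbT.
by case=> [[]|].
Qed.

Lemma big_kind_z (V : nmodType) (F : test -> V) :
  \sum_(a | kind a == Some true) F a = \sum_o F (Some (inr o)).
Proof.
rewrite (reindex_omap (fun o => Some (inr o))
  (fun a : test => if a is Some (inr o) then Some o else None)).
  by apply: eq_bigl => o /=; rewrite eqxx.
by case=> [[]|].
Qed.

Lemma sum_tens2 (R : realType) (S T J K : finType) (A : J -> op R S) (B : K -> op R T) :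
  \sum_(o : J * K) tens2 (A o.1) (B o.2) = tens2 (\sum_j A j) (\sum_k B k).
Proof.
apply: opP => x y; rewrite entry_sum !entry_mkop !entry_sum big_distrlr pair_bigA /=.
by apply: eq_bigr => o _; rewrite entry_mkop.
Qed.

Lemma sum_test_proj (R : realType) (q : option bool) :
  \sum_(a | kind a == q) test_proj R a = 1%:M.
Proof.
case: q => [[]|].
- rewrite big_kind_z /= (sum_tens2 (fun s => proj (ketZ R s)) (fun s => proj (ketZ R s))).
  by rewrite sum_proj_ketZ tens2_11.
- under eq_bigl do rewrite -[kind _ == _]andbT.
  rewrite big_kind_x /= (sum_tens2 (fun s => proj (ketX R s)) (fun s => proj (ketX R s))).
  by rewrite sum_proj_ketX tens2_11.
by rewrite (big_pred1 None) // => -[[]|].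
Qed.

(* An untested register is refined by the outcomes that the X test of it could
   have given. *)
Definition refine (a : test) : pred test :=
  fun b => if a is None then kind b == Some false else b == a.

Lemma sum_refine (R : realType) (a : test) :
  \sum_(b | refine a b) test_proj R b = test_proj R a.
Proof. by case: a => [a|]; [rewrite (big_pred1 (Some a))|exact: sum_test_proj]. Qed.

(** The Born probability of the outcomes once the X and Z sets are fixed, kept as a complex number
    so that positivity of traces applies directly. *)
Definition weight (R : realType) (n : nat)
    (rho : op R {ffun 'I_n -> bool * bool}) (c : test_record n) : R[i] :=
  \tr (record_proj R c *m rho).

Lemma weight_ge0 (R : realType) (n : nat) (rho : op R {ffun 'I_n -> bool * bool})
    (c : test_record n) : psd rho -> 0 <= weight rho c.
Proof.
by move=> rho_ge0; apply: psd_projection => //; apply: tens_projection => i;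
  apply: test_proj_projection.
Qed.

Lemma sum_weight (R : realType) (n : nat) (rho : op R {ffun 'I_n -> bool * bool})
    (Q : 'I_n -> pred test) :
  \sum_(c in family Q) weight rho c =
  \tr (tens (fun r => \sum_(a | Q r a) test_proj R a) *m rho).
Proof. by rewrite tens_sum mulmx_suml raddf_sum. Qed.

(** Completeness of the X measurement: a hypothetical test of every untested register, its outcome
    forgotten, changes no probability. *)
Lemma weight_refine (R : realType) (n : nat) (rho : op R {ffun 'I_n -> bool * bool})
    (c : test_record n) :
  weight rho c = \sum_(d in family (fun r => refine (c r))) weight rho d.
Proof.
rewrite sum_weight; congr (\tr (_ *m _)); apply: eq_tens => r.
by rewrite sum_refine.
Qed.

Lemma weight_refine_le (R : realType) (n : nat) (rho : op R {ffun 'I_n -> bool * bool})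
    (c d : test_record n) :
  psd rho -> d \in family (fun r => refine (c r)) -> weight rho d <= weight rho c.
Proof.
move=> rho_ge0 cd; rewrite [leRHS]weight_refine (bigD1 d) //= lerDl.
by apply: sumr_ge0 => e _; apply: weight_ge0.
Qed.

Lemma choice_prob_ge0 (R : realType) (k : nat) (c : test_record (4 * k)) :
  0 <= choice_prob R c.
Proof.
by rewrite /choice_prob; case: ifP => // _; rewrite mulr_ge0 // invr_ge0 ler0n.
Qed.

Lemma record_prob_ge0 (R : realType) (k : nat)
    (rho : op R {ffun 'I_(4 * k) -> bool * bool}) (c : test_record (4 * k)) :
  psd rho -> 0 <= record_prob rho c.
Proof.
move=> rho_ge0; rewrite mulr_ge0 ?choice_prob_ge0 //.
exact: (le_Re (weight_ge0 c rho_ge0)).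
Qed.

(** * Total mass of the test records *)

Definition kinds (n : nat) (c : test_record n) : {ffun 'I_n -> option bool} :=
  [ffun r => kind (c r)].

Definition kset (n : nat) (q : bool) (f : {ffun 'I_n -> option bool}) : {set 'I_n} :=
  [set r | f r == Some q].

Lemma Xset_kinds (n : nat) (c : test_record n) : Xset c = kset false (kinds c).
Proof. by apply/setP => r; rewrite !inE ffunE; case: (c r) => [[]|]. Qed.

Lemma Zset_kinds (n : nat) (c : test_record n) : Zset c = kset true (kinds c).
Proof. by apply/setP => r; rewrite !inE ffunE; case: (c r) => [[]|]. Qed.

(** An assignment of roles is determined by its X and Z sets, and the Z set is a [k]-subset of the
    [3 * k] registers outside the X set. *)
Lemma card_kinds (k : nat) :
  (#|[set f : {ffun 'I_(4 * k) -> option bool} |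
      (#|kset false f| == k) && (#|kset true f| == k)]|
   <= 'C(4 * k, k) * 'C(3 * k, k))%N.
Proof.
pose h (f : {ffun 'I_(4 * k) -> option bool}) := (kset false f, kset true f).
have h_inj : injective h.
  move=> f g [/setP fg /setP fg']; apply/ffunP => r.
  move: (fg r) (fg' r); rewrite !inE; case: (f r) => [[]|]; case: (g r) => [[]|] //=.
rewrite -(card_imset _ h_inj).
pose D := [set p : {set 'I_(4 * k)} * {set 'I_(4 * k)} |
  (#|p.1| == k) && ((p.2 \subset ~: p.1) && (#|p.2| == k))].
apply: (@leq_trans #|D|).
  apply: subset_leq_card; apply/fintype.subsetP => p /imsetP[f].
  rewrite inE => /andP[fX fZ] ->.
  rewrite inE /= fX fZ andbT /=; apply/fintype.subsetP => r; rewrite !inE => /eqP -> //.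
rewrite -sum1_card (eq_bigl (fun p : {set 'I_(4 * k)} * {set 'I_(4 * k)} =>
  (#|p.1| == k) && ((p.2 \subset ~: p.1) && (#|p.2| == k))));
  last by move=> p; rewrite inE.
rewrite -(pair_big_dep (fun A : {set 'I_(4 * k)} => #|A| == k)
  (fun A B : {set 'I_(4 * k)} => (B \subset ~: A) && (#|B| == k)) (fun _ _ => 1%N)) /=.
rewrite (eq_bigr (fun=> 'C(3 * k, k))) => [|A /eqP Ak].
  by rewrite sum_nat_const -[in leqRHS](card_ord (4 * k)) -card_draws cardsE.
rewrite sum1dep_card cards_draws; congr 'C(_, _).
by rewrite cardsCs finset.setCK card_ord Ak; lia.
Qed.

(** Records are grouped by their X and Z sets: within a group the weights sum to the trace of [rho],
    and [card_kinds] bounds the number of groups. *)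
Lemma sum_record_prob_le1 (R : realType) (k : nat)
    (rho : op R {ffun 'I_(4 * k) -> bool * bool}) :
  \tr rho = 1 -> \sum_c record_prob rho c <= 1.
Proof.
move=> rho1; pose V (f : {ffun 'I_(4 * k) -> option bool}) :=
  (#|kset false f| == k) && (#|kset true f| == k).
have cC (c : test_record (4 * k)) : choice_prob R c =
    if V (kinds c) then ('C(4 * k, k)%:R)^-1 * ('C(3 * k, k)%:R)^-1 else 0.
  by rewrite /choice_prob Xset_kinds Zset_kinds.
rewrite (partition_big (@kinds (4 * k)) predT) //=.
rewrite (eq_bigr (fun f => if V f
  then ('C(4 * k, k)%:R)^-1 * ('C(3 * k, k)%:R)^-1 else 0)).
  rewrite -big_mkcond sumr_const -[leLHS]mulr_natr -invfM -natrM.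
  have C0 : (0 < 'C(4 * k, k) * 'C(3 * k, k))%N by rewrite muln_gt0 !bin_gt0 !leq_pmull.
  rewrite mulrC ler_pdivrMr ?ltr0n // mul1r ler_nat.
  by apply: leq_trans (card_kinds k); rewrite cardsE.
move=> f _; rewrite (eq_bigr (fun c => (if V f then
  ('C(4 * k, k)%:R)^-1 * ('C(3 * k, k)%:R)^-1 else 0) * complex.Re (weight rho c))).
  rewrite -mulr_sumr -(raddf_sum (@complex.Re R : Rcomplex R -> R)) /=.
  have -> : \sum_(c | kinds c == f) weight rho c = 1; last by rewrite mulr1.
  transitivity (\sum_(c in family (fun r a => kind a == f r)) weight rho c).
    apply: eq_bigl => c; apply/eqP/familyP => [<- r|cf]; first by rewrite unfold_in ffunE.
    by apply/ffunP => r; rewrite ffunE; apply/eqP/cf.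
  rewrite sum_weight -[RHS]rho1; congr (\tr _).
  rewrite -[RHS]mul1mx -tens1; congr (_ *m _); apply: eq_tens => r.
  exact: sum_test_proj.
by move=> c /eqP <-; rewrite /record_prob cC.
Qed.

(** The total mass is at most 1 and [P] already carries mass 1, so a record outside [P] has
    probability zero. Its choice factor is nonzero, which leaves the weight. *)
Lemma weight_eq0 (R : realType) (k : nat)
    (rho : op R {ffun 'I_(4 * k) -> bool * bool}) (P : pred (test_record (4 * k)))
    (c : test_record (4 * k)) :
  psd rho -> \tr rho = 1 -> \sum_(c | P c) record_prob rho c = 1 ->
  #|Xset c| = k -> #|Zset c| = k -> ~~ P c -> weight rho c = 0.
Proof.
move=> rho_ge0 rho1 P1 cX cZ Pc.
have := sum_record_prob_le1 rho1; rewrite (bigID P) /= P1 gerDl => le0.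
have rec0 : record_prob rho c = 0.
  apply/eqP; rewrite eq_le record_prob_ge0 // andbT.
  apply: le_trans le0; rewrite (bigD1 c) //= lerDl.
  by apply: sumr_ge0 => d _; apply: record_prob_ge0.
move: rec0; rewrite /record_prob /choice_prob cX cZ eqxx /= => /eqP.
rewrite !mulf_eq0 !invr_eq0 !pnatr_eq0.
have -> : ('C(4 * k, k) == 0)%N = false by apply/negbTE; rewrite -lt0n bin_gt0 leq_pmull.
have -> : ('C(3 * k, k) == 0)%N = false by apply/negbTE; rewrite -lt0n bin_gt0 leq_pmull.
move=> /eqP Re0; apply/eqP; rewrite eq_complex /= -/(weight rho c) Re0.
by rewrite (ger0_Im (weight_ge0 c rho_ge0)) !eqxx.
Qed.

(** * Failures among the untested registers *)

Lemma exists_set_between (T : finType) (A U : {set T}) (m : nat) :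
  A \subset U -> (#|A| <= m <= #|U|)%N ->
  exists B : {set T}, [/\ A \subset B, B \subset U & #|B| = m].
Proof.
move=> AU /andP[Am mU].
have : (0 < #|[set B : {set T} | B \subset U :\: A & #|B| == (m - #|A|)%N]|)%N.
  rewrite cards_draws bin_gt0 cardsD (finset.setIidPr AU); lia.
case/card_gt0P => B; rewrite inE => /andP[BU /eqP Bm].
exists (A :|: B); split; first exact: finset.subsetUl.
  by rewrite finset.subUset AU (fintype.subset_trans BU) ?finset.subsetDl.
rewrite cardsU Bm (_ : A :&: B = finset.set0) ?cards0 ?subn0; first by lia.
apply/eqP; rewrite -finset.subset0; apply/fintype.subsetP => x.
by rewrite !inE => /andP[xA /(fintype.subsetP BU)]; rewrite inE xA.
Qed.

Lemma card_untested (k : nat) (c : test_record (4 * k)) :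
  #|Xset c| = k -> #|Zset c| = k -> #|[set r | c r == None]| = (2 * k)%N.
Proof.
move=> cX cZ.
have XZ : Xset c :&: Zset c = finset.set0.
  by apply/setP => r; rewrite !inE; case: (c r) => [[]|].
have -> : [set r | c r == None] = ~: (Xset c :|: Zset c).
  by apply/setP => r; rewrite !inE; case: (c r) => [[]|].
by rewrite cardsCs finset.setCK cardsU XZ cards0 card_ord cX cZ; lia.
Qed.

(* Otherwise an X set containing the failing untested registers would exceed the
   bound on the number of failures with positive probability. *)
Lemma card_untested_fails (R : realType) (k : nat)
    (rho : op R {ffun 'I_(4 * k) -> bool * bool}) (b : R)
    (c d : test_record (4 * k)) :
  psd rho -> \tr rho = 1 ->
  \sum_(e : test_record (4 * k) | (nfail e)%:R <= b) record_prob rho e = 1 ->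
  b < k%:R -> #|Xset c| = k -> #|Zset c| = k ->
  d \in family (fun r => refine (c r)) -> weight rho d != 0 ->
  #|[set r | (c r == None) && fails (d r)]|%:R <= b.
Proof.
move=> rho_ge0 rho1 sum1 bk cX cZ /familyP cd d0.
set U := [set r | c r == None]; set F := [set r | _].
have Ucard : #|U| = (2 * k)%N := card_untested cX cZ.
have FU : F \subset U by apply/fintype.subsetP => r; rewrite !inE => /andP[].
(* [A] collects as many failing untested registers as an X set can hold. *)
have [A [_ AF Ac]] : exists A : {set 'I_(4 * k)},
    [/\ finset.set0 \subset A, A \subset F & #|A| = minn #|F| k].
  by apply: exists_set_between; rewrite ?finset.sub0set // cards0 geq_minl.
have [X [AX XU Xk]] : exists X : {set 'I_(4 * k)},
    [/\ A \subset X, X \subset U & #|X| = k].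
  apply: exists_set_between; first exact: fintype.subset_trans AF FU.
  by rewrite Ac geq_minr Ucard leq_pmull.
(* The competing record: [X] replaces the X set with the outcomes of [d], the Z set of [c] is kept,
   and the old X set becomes untested. *)
pose e : test_record (4 * k) := [ffun r => if r \in X then d r
  else if c r is Some (inr _) then c r else None].
have dX r : c r = None -> kind (d r) = Some false.
  by move=> cr; have := cd r; rewrite unfold_in cr => /eqP.
have Xc r : r \in X -> c r = None.
  by move/(fintype.subsetP XU); rewrite inE => /eqP.
have eX : Xset e = X.
  apply/setP => r; rewrite inE ffunE; case: ifP => rX.
    by have := dX r (Xc r rX); case: (d r) => [[]|].
  by case: (c r) => [[]|].
have eZ : Zset e = Zset c.
  apply/setP => r; rewrite !inE ffunE; case: ifP => rX.
    by have := dX r (Xc r rX); rewrite (Xc r rX); case: (d r) => [[]|].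
  by case: (c r) => [[]|].
(* On registers untested in [e], [d] has X outcomes: those of [c] on its X set, hypothetical ones
   elsewhere. So [e] weighs at least as much as [d]. *)
have ed : d \in family (fun r => refine (e r)).
  apply/familyP => r; rewrite unfold_in ffunE; case: ifP => rX.
    by have := dX r (Xc r rX); rewrite /refine; case: (d r).
  move: (cd r) (dX r); rewrite unfold_in.
  by case: (c r) => [[u|u]|] //= /eqP ->.
have eb : (nfail e)%:R <= b.
  apply/negPn/negP => nb; move: d0; rewrite eq_le weight_ge0 // andbT.
  rewrite -(weight_eq0 rho_ge0 rho1 sum1 _ _ nb) ?eX ?eZ //.
  by rewrite weight_refine_le.
have Ae : (#|A| <= nfail e)%N.
  apply: subset_leq_card; apply/fintype.subsetP => r rA.
  rewrite inE /= ffunE (fintype.subsetP AX r rA).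
  by have := fintype.subsetP AF r rA; rewrite inE => /andP[].
have Ab : #|A|%:R <= b by apply: le_trans eb; rewrite ler_nat.
(* More than [k] failing registers would give [k <= b], against [b < k]. *)
move: Ab; rewrite Ac; case: (leqP #|F| k) => // _ kb.
by have := le_lt_trans kb bk; rewrite ltxx.
Qed.

(** * The target state *)

(** At the untested [r] the record projector is the identity, so [B] stands there alone; elsewhere
    its two copies merge by cyclicity and idempotence. *)
Lemma tr_marginal_post (R : realType) (n : nat)
    (rho : op R {ffun 'I_n -> bool * bool}) (c : test_record n) (r : 'I_n)
    (B : op R (bool * bool)%type) :
  c r = None ->
  \tr (B *m marginal r (post_test rho c)) = (weight rho c)^-1 *
  \tr (tens (fun q => if q == r then B else test_proj R (c q)) *m rho).
Proof.
move=> cr; rewrite tr_marginal /post_test -scalemxAr mxtraceZ; congr (_ * _).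
rewrite mulmxA mxtrace_mulC !mulmxA; congr (\tr (_ *m _)).
rewrite /record_proj !tensM; apply: eq_tens => q.
case: eqP => [->|_]; first by rewrite cr mul1mx mulmx1.
by have [_ PP] := test_proj_projection R (c q); rewrite mulmx1 PP.
Qed.

(** Testing [r] alone fails with the same probability as testing [r] along with all untested
    registers, since the other outcomes sum to the identity. *)
Lemma sum_mismatch (R : realType) (n : nat)
    (rho : op R {ffun 'I_n -> bool * bool}) (c : test_record n) (r : 'I_n) :
  c r = None ->
  \sum_(o : bool * bool | o.1 != o.2) \tr (tens (fun q =>
    if q == r then tens2 (proj (ketX R o.1)) (proj (ketX R o.2))
    else test_proj R (c q)) *m rho) =
  \sum_(d in family (fun q => refine (c q)) | fails (d r)) weight rho d.
Proof.
move=> cr.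
transitivity (\sum_(a | (kind a == Some false) && fails a) \tr (tens (fun q =>
    if q == r then test_proj R a else test_proj R (c q)) *m rho)).
  by rewrite big_kind_x.
rewrite [RHS](partition_big (fun d : test_record n => d r)
  (fun a => (kind a == Some false) && fails a)) /=; last first.
  move=> d /andP[/familyP /(_ r)]; rewrite unfold_in cr /= => -> //.
apply: eq_bigr => a /andP[ka fa].
transitivity (\sum_(d in family (fun q =>
    if q == r then (pred1 a : pred test) else refine (c q))) weight rho d).
  rewrite sum_weight; congr (\tr (_ *m _)); apply: eq_tens => q.
  by case: eqP => _; rewrite ?sum_refine // (big_pred1 a).
apply: eq_bigl => d; apply/familyP/andP => [H | [/andP[/familyP H _] /eqP da] q].
  have /eqP da : d r == a by have := H r; rewrite eqxx.
  split; last by rewrite da.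
  rewrite da fa andbT; apply/familyP => q.
  have := H q; case: eqP => // -> _.
  by rewrite cr da; exact: ka.
by case: eqP => [->|_]; [rewrite da; apply: eqxx | apply: H].
Qed.

Lemma psd_target_state (R : realType) (k : nat)
    (rho : op R {ffun 'I_(4 * k) -> bool * bool}) (c : test_record (4 * k)) :
  psd rho -> psd (target_state rho c).
Proof.
move=> rho_ge0; apply: psdZ; first by rewrite invr_ge0 ler0n.
apply: psd_sum => r _; apply: psd_marginal; apply: psdZ.
  by rewrite invr_ge0; apply: weight_ge0.
apply: psd_compress => //.
have [] // : projection (record_proj R c).
by apply: tens_projection => i; apply: test_proj_projection.
Qed.

Lemma tr_target_state (R : realType) (k : nat)
    (rho : op R {ffun 'I_(4 * k) -> bool * bool}) (c : test_record (4 * k)) :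
  (0 < k)%N -> #|Xset c| = k -> #|Zset c| = k -> weight rho c != 0 ->
  \tr (target_state rho c) = 1.
Proof.
move=> k0 cX cZ c0; rewrite mxtraceZ raddf_sum /=.
rewrite (eq_bigr (fun=> 1)) => [|r /eqP cr].
  rewrite sumr_const -(card_untested cX cZ) cardsE mulVf // pnatr_eq0.
  by rewrite -cardsE card_untested // muln_eq0 -lt0n k0.
rewrite -[marginal _ _]mul1mx tr_marginal_post //.
rewrite [X in _^-1 * X](_ : _ = weight rho c) ?mulVf //.
congr (\tr (_ *m _)); apply: eq_tens => q.
by case: eqP => // ->; rewrite cr.
Qed.

(** Averaging over the target makes the mismatch probability the expected number of failures among
    the [2 * k] untested registers, divided by [2 * k]; [card_untested_fails] bounds this number on
    every refined record of nonzero weight. *)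
Lemma mismatch_target_state (R : realType) (k : nat)
    (rho : op R {ffun 'I_(4 * k) -> bool * bool}) (Delta : R) (c : test_record (4 * k)) :
  psd rho -> \tr rho = 1 -> 2 * Delta < 1 -> (0 < k)%N ->
  \sum_(e : test_record (4 * k) | (nfail e)%:R <= 2 * k%:R * Delta)
    record_prob rho e = 1 ->
  #|Xset c| = k -> #|Zset c| = k -> weight rho c != 0 ->
  mismatch_x (target_state rho c) <= Delta.
Proof.
move=> rho_ge0 rho1 D1 k0 sum1 cX cZ c0.
have bk : 2 * k%:R * Delta < k%:R by rewrite mulrAC gtr_pMl ?ltr0n.
pose f (d : test_record (4 * k)) : nat := #|[set r | (c r == None) && fails (d r)]|.
(* Exchanging the sums over registers and over refined records [d] makes the failure count [f d]
   appear. *)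
have -> : mismatch_x (target_state rho c) = complex.Re (((2 * k)%:R)^-1 *
    ((weight rho c)^-1 *
    \sum_(d in family (fun q => refine (c q))) (f d)%:R * weight rho d)).
  congr complex.Re.
  transitivity (((2 * k)%:R)^-1 *
      \sum_(r | c r == None) \sum_(o : bool * bool | o.1 != o.2)
      \tr (tens2 (proj (ketX R o.1)) (proj (ketX R o.2)) *m
           marginal r (post_test rho c))).
    rewrite [in RHS]exchange_big mulr_sumr; apply: eq_bigr => o _.
    by rewrite /target_state -scalemxAr mxtraceZ mulmx_sumr raddf_sum.
  congr (_ * _); rewrite mulr_sumr.
  transitivity (\sum_(r | c r == None) (weight rho c)^-1 *
      \sum_(d in family (fun q => refine (c q)) | fails (d r)) weight rho d).
    apply: eq_bigr => r /eqP cr; rewrite -sum_mismatch // mulr_sumr.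
    by apply: eq_bigr => o _; rewrite tr_marginal_post.
  under eq_bigr do rewrite mulr_sumr big_mkcondr.
  rewrite exchange_big /=; apply: eq_bigr => d _.
  rewrite -big_mkcondr /= sumr_const mulrCA mulr_natl -cardsE; congr (_ *+ _).
have w_gt0 : 0 < weight rho c by rewrite lt0r c0 weight_ge0.
have : \sum_(d in family (fun q => refine (c q))) (f d)%:R * weight rho d <=
    (2 * k%:R * Delta)%:C%C * weight rho c.
  rewrite [weight rho c]weight_refine mulr_sumr; apply: ler_sum => d cd.
  have [->|d0] := eqVneq (weight rho d) 0; first by rewrite !mulr0.
  apply: ler_wpM2r; first exact: weight_ge0.
  rewrite -(rmorph_nat (real_complex R)) lecR.
  exact: card_untested_fails rho_ge0 rho1 sum1 bk cX cZ cd d0.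
rewrite -ler_pdivrMr // mulrC => le.
have k2 : 0 < (2 * k)%:R :> R[i] by rewrite ltr0n muln_gt0.
have : ((2 * k)%:R)^-1 * ((weight rho c)^-1 *
    \sum_(d in family (fun q => refine (c q))) (f d)%:R * weight rho d) <= Delta%:C%C.
  rewrite mulrC ler_pdivrMr // (le_trans le) //.
  by rewrite -(rmorph_nat (real_complex R)) -(rmorphM (real_complex R)) lecR natrM mulrC.
exact: le_Re.
Qed.

Lemma record_prob_neq0 (R : realType) (k : nat)
    (rho : op R {ffun 'I_(4 * k) -> bool * bool}) (c : test_record (4 * k)) :
  record_prob rho c != 0 -> [/\ #|Xset c| = k, #|Zset c| = k & weight rho c != 0].
Proof.
rewrite /record_prob mulf_eq0 negb_or /choice_prob; case: ifP; last by rewrite eqxx.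
move=> /andP[/eqP cX /eqP cZ] /andP[_ w0]; split => //.
by apply: contraNneq w0; rewrite /weight => ->.
Qed.

(** * Mean square error of the estimator *)

(** Independence and centring kill the cross terms: variances add up, and the bias [b] enters
    through its square. *)
Lemma expectation_sqr_sum (R : comNzRingType) (I J : finType)
    (p a : I -> J -> R) (b : R) :
  (forall i, \sum_x p i x = 1) -> (forall i, \sum_x p i x * a i x = 0) ->
  \sum_(m : {ffun I -> J}) (\prod_i p i (m i)) * (\sum_i a i (m i) + b) ^+ 2 =
  \sum_i \sum_x p i x * a i x ^+ 2 + b ^+ 2.
Proof.
move=> p1 pa0.
(* Expectations of products over the coordinates factorise; [E1] and [E2] take all factors equal to
   1 except at [i] and [j]. *)
have E (h : I -> J -> R) : \sum_(m : {ffun I -> J}) (\prod_i p i (m i)) *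
    (\prod_i h i (m i)) = \prod_i \sum_x p i x * h i x.
  by rewrite bigA_distr_bigA; apply: eq_bigr => m _; rewrite big_split.
have E1 i : \sum_(m : {ffun I -> J}) (\prod_i p i (m i)) * a i (m i) = 0.
  transitivity (\prod_l \sum_x p l x * (if l == i then a l x else 1)).
    rewrite -E; apply: eq_bigr => m _; congr (_ * _).
    by rewrite -big_mkcond big_pred1_eq.
  rewrite (bigD1 i) //= [X in X * _](_ : _ = 0) ?mul0r // -[RHS](pa0 i).
  by apply: eq_bigr => x _; rewrite eqxx.
have E2 i j : \sum_(m : {ffun I -> J}) (\prod_i p i (m i)) * (a i (m i) * a j (m j)) =
    if i == j then \sum_x p i x * a i x ^+ 2 else 0.
  transitivity (\prod_l \sum_x p l x *
      ((if l == i then a l x else 1) * (if l == j then a l x else 1))).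
    rewrite -E; apply: eq_bigr => m _; congr (_ * _).
    by rewrite big_split -!big_mkcond !big_pred1_eq.
  rewrite (bigD1 i) //= eqxx; case: eqVneq => [<-|ij].
    rewrite [X in _ * X]big1 ?mulr1 => [|l /negbTE li];
      first by apply: eq_bigr => x _; rewrite expr2.
    by rewrite li -[RHS](p1 l); apply: eq_bigr => x _; rewrite !mulr1.
  rewrite [X in X * _](_ : _ = 0) ?mul0r // -[RHS](pa0 i).
  by apply: eq_bigr => x _; rewrite mulr1.
pose W (m : {ffun I -> J}) := \prod_i p i (m i).
pose S (m : {ffun I -> J}) := \sum_i a i (m i).
have W1 : \sum_m W m = 1.
  by rewrite -bigA_distr_bigA big1.
have WS : \sum_m W m * S m = 0.
  under eq_bigr do rewrite mulr_sumr.
  by rewrite exchange_big big1.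
have WSS : \sum_m W m * (S m * S m) = \sum_i \sum_x p i x * a i x ^+ 2.
  under eq_bigr do rewrite big_distrlr /= mulr_sumr.
  rewrite exchange_big /=; apply: eq_bigr => i _.
  under eq_bigr do rewrite mulr_sumr.
  rewrite exchange_big /= (eq_bigr _ (fun j _ => E2 i j)) -big_mkcond.
  by rewrite (big_pred1 i) // => j; rewrite eq_sym.
transitivity (\sum_m (W m * (S m * S m) + W m * S m * (b *+ 2) + W m * b ^+ 2)).
  by apply: eq_bigr => m _; rewrite -/(W m) -/(S m); ring.
by rewrite !big_split /= -!mulr_suml WSS WS W1; ring.
Qed.

(** Bias and variance: the variance of each recorded bit is at most 1/4, and the bias is at most
    [(y + |omega * t|) / t]. *)
Lemma uncertainty_le (R : realType) (M : nat) (hbar omega t y : R)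
    (tau : 'I_M -> op R (bool * bool)%type) :
  (0 < M)%N -> 0 < t ->
  (forall j, recorded_prob hbar omega t (tau j) false =
    1 - recorded_prob hbar omega t (tau j) true) ->
  (forall j, `|2 * recorded_prob hbar omega t (tau j) true - 1| <= y) ->
  uncertainty hbar omega t tau <=
  1 / t * Num.sqrt (1 / M%:R + (y + `|omega * t|) ^+ 2).
Proof.
move=> M0 t0 qF qy.
have tN0 : t != 0 by rewrite gt_eqF.
have MN0 : M%:R != 0 :> R by rewrite pnatr_eq0 -lt0n.
pose q j := recorded_prob hbar omega t (tau j) true.
(* The coefficient of one recorded bit in the estimator; [a] is the centred contribution of a bit
   and [b] the bias. *)
pose k := 2 / (M%:R * t).
pose a (j : 'I_M) (x : bool) := k * (x%:R - q j).
pose b := (\sum_j (2 * q j - 1)) / (M%:R * t) - omega.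
have t2 : 1 / t = Num.sqrt ((1 / t) ^+ 2).
  by rewrite sqrtr_sqr ger0_norm // divr_ge0 // ltW.
rewrite t2 -sqrtrM ?sqr_ge0 //; apply: ler_wsqrtr.
have est (m : {ffun 'I_M -> bool}) : estimator t m - omega = \sum_j a j (m j) + b.
  rewrite /estimator /a /b -mulr_sumr !big_split /= !sumrN -!mulr_sumr.
  rewrite sumr_const card_ord.
  by rewrite /k; field; rewrite tN0 MN0.
under eq_bigr do rewrite est.
rewrite (expectation_sqr_sum (p := fun j => recorded_prob hbar omega t (tau j)));
  first last.
- by move=> j; rewrite big_bool /= qF /a -/(q j) /=; ring.
- by move=> j; rewrite big_bool /= qF; ring.
rewrite [leRHS]mulrDr lerD //.
  apply: (@le_trans _ _ (\sum_(j < M) k ^+ 2 / 4)).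
    apply: ler_sum => j _; rewrite big_bool /= qF /a -/(q j).
    (* The gap between 1/4 and [q j * (1 - q j)] is a square. *)
    rewrite -subr_ge0 [leRHS](_ : _ = (k * (q j - 1 / 2)) ^+ 2) ?sqr_ge0 //=.
    by field.
  rewrite sumr_const card_ord -mulr_natr /k.
  by rewrite le_eqVlt; apply/orP; left; apply/eqP; field; rewrite tN0 MN0.
rewrite -exprMn -(real_normK (num_real b)) lerXn2r ?nnegrE //.
  rewrite mulr_ge0 // ?divr_ge0 ?(ltW t0) // addr_ge0 //.
  by rewrite (le_trans _ (qy (Ordinal M0))).
have -> : b = 1 / t * ((\sum_j (2 * q j - 1)) / M%:R - omega * t).
  by rewrite /b; field; rewrite tN0 MN0.
rewrite normrM ger0_norm ?divr_ge0 ?(ltW t0) // ler_wpM2l ?divr_ge0 ?(ltW t0) //.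
rewrite (le_trans (ler_normB _ _)) // lerD2r normrM normfV normr_nat.
rewrite ler_pdivrMr ?ltr0n // (le_trans (ler_norm_sum _ _ _)) //.
apply: le_trans (ler_sum _ (fun j _ => qy j)) _.
by rewrite sumr_const card_ord mulr_natr.
Qed.

(** * The limit of small [omega] and the conclusion *)

Local Open Scope classical_set_scope.
Local Open Scope ring_scope.

(** Both terms are continuous and vanish at 0. They are the errors of first order in [omega] left by
    [recorded_prob_true] and [uncertainty_le]. *)
Lemma near_sin_small (R : realType) (t g : R) : 0 < t -> 0 < g ->
  \forall omega \near (0 : R), `|sin (omega * t)| + `|omega * t| <= g.
Proof.
move=> t0 g0.
have c : (fun omega : R => `|sin (omega * t)| + `|omega * t|) @ (0 : R) --> (0 : R).
  have ct : (fun omega : R => omega * t) @ (0 : R) --> 0 * t.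
    by apply: cvgMr_tmp; apply: cvg_id.
  have at0 : `|sin (0 * t)| + `|0 * t| = 0 by rewrite mul0r sin0 normr0 addr0.
  rewrite -[X in _ --> X]at0; apply: cvgD; apply: cvg_norm => //.
  by apply: (continuous_cvg _ _ ct); apply: continuous_sin.
move/cvgr_norm_le : c; rewrite normr0 => /(_ _ g0) c.
near=> w.
have : `| `|sin (w * t)| + `|w * t| | <= g by near: w.
by rewrite ger0_norm // addr_ge0.
Unshelve. all: by end_near. Qed.

Theorem theorem3 (R : realType) (hbar eps delta Delta t : R) (M k : nat)
  (rho : 'I_M -> op R {ffun 'I_(4 * k) -> bool * bool})
  (hbar_gt0 : 0 < hbar)
  (eps_bounds : 0 < eps < 1 / 2)
  (delta_bounds : 0 < delta <= 1)
  (Delta_bounds : 0 <= Delta < eps / 3)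
  (t_gt0 : 0 < t)
  (M_ge1 : (1 <= M)%N)
  (k_def : k%:Z = Num.ceil (75 / (8 * (eps - 3 * Delta) ^+ 2) * ln (2 / delta)))
  (rho_density : forall j, density (rho j))
  (nfail_le : forall j,
    \sum_(c : test_record (4 * k) | (nfail c)%:R <= 2 * k%:R * Delta)
      record_prob (rho j) c = 1) :
  \forall omega \near (0 : R),
    (1 - delta) ^+ M <=
    runs_prob rho (fun c =>
      uncertainty hbar omega t (fun j => target_state (rho j) (c j))
      <= 1 / t * Num.sqrt (1 / M%:R + 4 * (eps - eps ^+ 2))).
Proof.
(* [Delta < eps / 3] makes the coefficient positive, and [delta <= 1] makes the logarithm
   positive. *)
have k0 : (0 < k)%N.
  rewrite -ltz_nat k_def ceil_gt0 mulr_gt0 //.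
    by rewrite divr_gt0 // mulr_gt0 // exprn_gt0 //; lra.
  apply: ln_gt0; case/andP: delta_bounds => d0 d1.
  by rewrite ltr_pdivlMr // mul1r; lra.
have psd_rho j : psd (rho j) := density_psd (rho_density j).
have tr_rho j : \tr (rho j) = 1 by case: (rho_density j).
set y := 2 * Num.sqrt (Delta - Delta ^+ 2).
set z := 2 * Num.sqrt (eps - eps ^+ 2).
(* The map sending x to x - x^2 is strictly increasing on [0, 1/2], and [Delta < eps < 1 / 2]. *)
have yz : y < z by rewrite ltr_pM2l // ltr_sqrt; nra.
have zz : z ^+ 2 = 4 * (eps - eps ^+ 2).
  by rewrite exprMn sqr_sqrtr; [ring | nra].
have := near_sin_small t_gt0 (_ : 0 < z - y); rewrite subr_gt0 => /(_ yz).
apply: filterS => omega small; rewrite -zz.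
pose ok (c : test_record (4 * k)) := (nfail c)%:R <= 2 * k%:R * Delta.
have total : \sum_(c in family (fun (_ : 'I_M) => ok))
    \prod_j record_prob (rho j) (c j) = 1.
  by rewrite -(bigA_distr_big_dep (fun=> ok) (fun j c => record_prob (rho j) c)) big1.
(* It remains to compare the full mass [total] with the mass of the event, term by term. *)
apply: (@le_trans _ _ 1); first by rewrite exprn_ile1 //; lra.
rewrite -[leLHS]total.
rewrite /runs_prob big_mkcond [leRHS]big_mkcond; apply: ler_sum => c _.
have prod_ge0 : 0 <= \prod_j record_prob (rho j) (c j).
  by apply: prodr_ge0 => j _; apply: record_prob_ge0.
case: ifPn => _; last by case: ifP.
(* A tuple outside the event has probability zero: with all factors nonzero, the bounds on its
   target states would put it into the event. *)
case: ifPn => // not_small; rewrite le_eqVlt; apply/orP; left.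
apply/negPn/negP => /prodf_neq0 pos.
case/negP: not_small.
have tgt j := record_prob_neq0 (pos j isT).
apply: le_trans (uncertainty_le (y := y + `|sin (omega * t)|) _ _ _ _) _ => //.
- move=> j; have [cX cZ c0] := tgt j.
  by apply: recorded_prob_false; rewrite ?gt_eqF // tr_target_state.
- move=> j; have [cX cZ c0] := tgt j.
  apply: recorded_prob_true; rewrite ?gt_eqF ?tr_target_state //.
  + exact: psd_target_state.
  + by apply: mismatch_target_state => //; lra.
  + lra.
apply: ler_wpM2l; first by rewrite divr_ge0 // ltW.
apply: ler_wsqrtr; rewrite lerD2l lerXn2r ?nnegrE //.
- by rewrite !addr_ge0 // mulr_ge0 // sqrtr_ge0.
- by rewrite mulr_ge0 // sqrtr_ge0.
by rewrite -addrA -lerBrDl.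
Qed.
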